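(* Let $f:\mathbb{R}^d\to\mathbb{R}$ be convex and $1$-smooth, let $h:\mathbb{R}^d\to\mathbb{R}\cup\{+\infty\}$ be proper, closed and convex, and let $F=f+h$. For $k\in\mathbb{N}$, $k\ge1$, and $n=2^k-1$, let $x_0\in\mathbb{R}^d$ and let $$x_t=\mathrm{prox}_{w^{(k)}_t h}\big(x_{t-1}-w_t^{(k)}\nabla f(x_{t-1})\big),\qquad 1\le t\le n,$$ be the iterates of proximal gradient descent with stepsizes $w^{(k)}$. Then $$\|\nabla f(x_n)+s_n\|^2\le\frac{2\sqrt2}{\tau_k}\big(F(x_0)-F(x_n)\big),$$ where $s_n=\frac{1}{w_n^{(k)}}(x_{n-1}-x_n)-\nabla f(x_{n-1})\in\partial h(x_n)$. Moreover $\dfrac{2\sqrt2}{\tau_k}\sim\dfrac{\sqrt2(\rho-\sqrt\rho)}{n^{\log_2\rho}}$ as $k\to\infty$.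
   Context: $\rho=1+\sqrt2$. The silver stepsize schedule of length $2^k-1$ is $\pi^{(k)}$ with $\pi_i^{(k)}=1+\rho^{\nu(i)-1}$, $1\le i\le 2^k-1$, where $\nu(i)$ is the largest integer $j$ such that $2^j$ divides $i$. Define $\tau_1=4$ and, for $k\ge1$, $$\tau_{k+1}=\tfrac12\big(\tau_k+4\rho^k+\sqrt{\tau_k^2+8\rho^k\tau_k}\big),\qquad \eta_k=1+\frac{\sqrt{\tau_k^2+8\rho^k\tau_k}-\tau_k}{4}.$$ The stepsize schedule $w^{(k)}$ of length $2^k-1$ is defined by $w^{(1)}=[3/2]$ and $w^{(k+1)}=[w^{(k)},\eta_k,\pi^{(k)}]$ (concatenation). $\mathrm{prox}_{\alpha h}(x)=\arg\min_z\{\alpha h(z)+\frac12\|z-x\|^2\}$. $1$-smooth means differentiable with $1$-Lipschitz gradient. $a_n\sim b_n$ means $a_n/b_n\to1$. *)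

(* Defs.v *)
From HB Require Import structures.
From mathcomp Require Export all_boot all_order all_algebra.
From mathcomp Require Export all_classical all_reals all_analysis.

Set Implicit Arguments.
Unset Strict Implicit.
Unset Printing Implicit Defensive.

Export Order.TTheory GRing.Theory Num.Theory.
Export numFieldNormedType.Exports.

Local Open Scope classical_set_scope.
Local Open Scope ring_scope.

(* The library norm `|x| on 'rV[R]_d is the sup norm, hence the Euclidean inner
   product and norm below.  The topology is the same for both norms. *)
Definition dot (R : realType) (d : nat) (x y : 'rV[R]_d) : R :=
  \sum_(i < d) x 0 i * y 0 i.

Definition enorm (R : realType) (d : nat) (x : 'rV[R]_d) : R :=
  Num.sqrt (dot x x).

Definition gradient (R : realType) (d : nat) (f : 'rV[R]_d -> R)
    (x : 'rV[R]_d) : 'rV[R]_d :=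
  \row_(i < d) 'D_(delta_mx 0 i) f x.

Definition smooth1 (R : realType) (d : nat) (f : 'rV[R]_d -> R) : Prop :=
  (forall x : 'rV[R]_d, differentiable f x) /\
  (forall x y : 'rV[R]_d, enorm (gradient f x - gradient f y) <= enorm (x - y)).

Definition proper_fun (R : realType) (d : nat) (h : 'rV[R]_d -> \bar R) : Prop :=
  (forall x, h x != -oo%E) /\ (exists x, (h x < +oo)%E).

Definition epigraph (R : realType) (d : nat) (h : 'rV[R]_d -> \bar R) :
    set ('rV[R]_d * R) :=
  [set p | (h p.1 <= p.2%:E)%E].

Definition closed_fun (R : realType) (d : nat) (h : 'rV[R]_d -> \bar R) : Prop :=
  closed (epigraph h).

(* Meant for functions that never take the value -oo; at the endpoints the
   library convention 0 * +oo = 0 makes the inequality trivial. *)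
Definition econvex_fun (R : realType) (d : nat) (h : 'rV[R]_d -> \bar R) : Prop :=
  forall (x y : 'rV[R]_d) (t : R), 0 <= t <= 1 ->
    (h (t *: x + (1 - t) *: y)%R <= t%:E * h x + (1 - t)%:E * h y)%E.

Definition subdifferential (R : realType) (d : nat) (h : 'rV[R]_d -> \bar R)
    (x : 'rV[R]_d) : set 'rV[R]_d :=
  [set s | forall y : 'rV[R]_d, (h x + (dot s (y - x)%R)%:E <= h y)%E].

Definition argmin (R : realType) (d : nat) (g : 'rV[R]_d -> \bar R) :
    set 'rV[R]_d :=
  [set z | forall y : 'rV[R]_d, (g z <= g y)%E].

Definition prox_obj (R : realType) (d : nat) (alpha : R)
    (h : 'rV[R]_d -> \bar R) (x z : 'rV[R]_d) : \bar R :=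
  (alpha%:E * h z + (2^-1 * enorm (z - x) ^+ 2)%:E)%E.

(* For alpha > 0 and h proper, closed and convex, the argmin is a singleton and
   prox is its element; the default value x of xget is then never used. *)
Definition prox (R : realType) (d : nat) (alpha : R) (h : 'rV[R]_d -> \bar R)
    (x : 'rV[R]_d) : 'rV[R]_d :=
  xget x (argmin (prox_obj alpha h x)).

Definition rho (R : realType) : R := 1 + Num.sqrt 2.

(* Schedules are lists, so the i-th step (i >= 1) sits at position i - 1.  The
   exponent nu(i) - 1 is an integer, equal to -1 for odd i. *)
Definition silver (R : realType) (k : nat) : seq R :=
  mkseq (fun i => 1 + rho R ^ ((logn 2 i.+1)%:Z - 1)) (2 ^ k - 1)%N.

(* tau and sched are only meaningful for indices k >= 1; the values at 0 are
   dummies. *)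
Fixpoint tau (R : realType) (k : nat) : R :=
  match k with
  | 0 => 0
  | 1 => 4
  | j.+1 =>
      2^-1 * (tau R j + 4 * rho R ^+ j
              + Num.sqrt (tau R j ^+ 2 + 8 * rho R ^+ j * tau R j))
  end.

Definition eta (R : realType) (k : nat) : R :=
  1 + (Num.sqrt (tau R k ^+ 2 + 8 * rho R ^+ k * tau R k) - tau R k) / 4.

Fixpoint sched (R : realType) (k : nat) : seq R :=
  match k with
  | 0 => [::]
  | 1 => [:: 3 / 2]
  | j.+1 => sched R j ++ eta R j :: silver R j
  end.

Definition step (R : realType) (k t : nat) : R := nth 0 (sched R k) t.-1.

Definition asymp_equiv (R : realType) (a b : nat -> R) : Prop :=
  (fun k => a k / b k) @ \oo --> (1 : R).

(* Main.v *)
(* The silver blocks are analysed through reference points r, which carry a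
   function value, a gradient, a subgradient and a value of h, and satisfy
   co-coercivity of f and the subgradient inequality of h against all iterates;
   with nu = (gradient + subgradient) at r and z = x_r - nu, the quantities
     val r = F(r) - |nu|^2/2      and      pot r i = |x_i - z|^2/2 - <s_r, x_i> + h(x_i)
   drive two inequalities for a block of length 2^k - 1 with a = rho^k ending
   at an iterate m with vector nu:
     (a - 1)(val r - val m) >= (a^2 - 1)/2 E_m + pot r m - pot r b,
     pot m b - pot m m + sqrt2 (slack at b) >= (a^2 + 1)/2 E_m - |nu|^2,
   where E_m = |nu|^2 + sqrt2 (|g_m + s_m|^2 - |nu|^2)/2.  Both are proved by
   induction on k: two blocks are glued along the middle step 1 + a/rho, and
   rho^2 = 2 rho + 1 makes the coefficients match.  Together they show that one
   more block of the schedule, preceded by the step 1 + e, satisfies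
     a^2 E_m <= (a - e)(val n - val m) + e^2 E_n,
   and e = eta_k - 1 has 2 e^2 = tau_k (a - e), 2 a^2 = tau_(k+1) (a - e), so that
   tau_k E/2 bounds the decrease of F for every k.  The choice nu = 0 at the
   last iterate gives the rate.  For the asymptotics, tau_k / rho^k is the orbit
   of a contraction with fixed point 2 / (rho - sqrt rho). *)
Require Import Defs.
From mathcomp Require Import ring lra zify.

Set Implicit Arguments.
Unset Strict Implicit.
Unset Printing Implicit Defensive.

Local Open Scope classical_set_scope.
Local Open Scope ring_scope.

(** * Bilinear algebra of the Euclidean inner product *)

Section Dot.
Context (R : realType) (d : nat).
Implicit Types (x y z : 'rV[R]_d) (a : R).

Lemma dotC x y : dot x y = dot y x.
Proof. by apply: eq_bigr => i _; rewrite mulrC. Qed.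

Lemma dotDl x y z : dot (x + y) z = dot x z + dot y z.
Proof. by rewrite /dot -big_split; apply: eq_bigr => i _; rewrite mxE mulrDl. Qed.

Lemma dotNl x y : dot (- x) y = - dot x y.
Proof. by rewrite /dot -sumrN; apply: eq_bigr => i _; rewrite mxE mulNr. Qed.

Lemma dotZl a x y : dot (a *: x) y = a * dot x y.
Proof. by rewrite /dot mulr_sumr; apply: eq_bigr => i _; rewrite mxE mulrA. Qed.

Lemma dotDr x y z : dot x (y + z) = dot x y + dot x z.
Proof. by rewrite dotC dotDl !(dotC x). Qed.

Lemma dotNr x y : dot x (- y) = - dot x y.
Proof. by rewrite dotC dotNl dotC. Qed.

Lemma dotZr a x y : dot x (a *: y) = a * dot x y.
Proof. by rewrite dotC dotZl dotC. Qed.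

Lemma dot0r x : dot x 0 = 0.
Proof. by rewrite -(scale0r 0) dotZr mul0r. Qed.

Lemma dot0l x : dot 0 x = 0.
Proof. by rewrite dotC dot0r. Qed.

Lemma dot_ge0 x : 0 <= dot x x.
Proof. by apply: sumr_ge0 => i _; rewrite -expr2 sqr_ge0. Qed.

Lemma dot_sqrD x y : dot (x + y) (x + y) = dot x x + 2 * dot y x + dot y y.
Proof. by rewrite dotDl !dotDr (dotC x y); ring. Qed.

Definition dotE := (dotDl, dotDr, dotNl, dotNr, dotZl, dotZr, dot0r, dot0l).

End Dot.

(** With [j = c * p ^ l], [c] prime to [p] and [l < k], the sum is [p ^ l * (p ^ (k - l) + c)],
    whose second factor is prime to [p]. For [p = 2] this makes the second half of a silver schedule
    repeat the first. *)
Lemma logn_expD (p k j : nat) : prime p -> (0 < j < p ^ k)%N ->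
  logn p (p ^ k + j)%N = logn p j.
Proof.
move=> p_pr /andP[j0 jk].
have [c cop jE] := pfactor_coprime p_pr j0.
set l := logn p j in jE *.
have p0 := prime_gt0 p_pr.
have lk : (l < k)%N.
  rewrite -(ltn_exp2l _ _ (prime_gt1 p_pr)) (leq_ltn_trans _ jk) //.
  by rewrite dvdn_leq // pfactor_dvdnn.
rewrite {1}jE -(subnK (ltnW lk)) expnD -mulnDl lognM ?addn_gt0 ?expn_gt0 ?p0 //.
rewrite pfactorK // logn_coprime //.
by rewrite -(subnSK lk) expnS mulnC /coprime gcdnMDl.
Qed.

(** * Arithmetic of the silver ratio *)

Section SilverRatio.
Context (R : realType).

Lemma sqr_sqrt2 : Num.sqrt 2 * Num.sqrt 2 = 2 :> R.
Proof. by rewrite -expr2 sqr_sqrtr ?ler0n. Qed.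

Lemma sqrt2_gt1 : 1 < Num.sqrt 2 :> R.
Proof. by rewrite -[ltLHS]sqrtr1 ltr_sqrt ?ltr1n. Qed.

Lemma sqrt2_lt32 : Num.sqrt 2 < 3 / 2 :> R.
Proof. by have := sqr_sqrt2; have := sqrt2_gt1; nra. Qed.

Lemma rho_sqr : rho R * rho R = 2 * rho R + 1.
Proof. by rewrite /rho; have := sqr_sqrt2; lra. Qed.

Lemma rho_gt0 : 0 < rho R.
Proof. by rewrite addr_gt0 // sqrtr_gt0. Qed.

Lemma rho_neq0 : rho R != 0.
Proof. by rewrite gt_eqF // rho_gt0. Qed.

Lemma rho_gt2 : 2 < rho R.
Proof. by rewrite /rho; have := sqrt2_gt1; lra. Qed.

(** The terms left over when two silver blocks are glued. The coefficient of [v] vanishes by rho^2 =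
    2 rho + 1; after replacing [gap] by [q], the coefficient of [q] is a quadratic in [e] that is
    positive once e >= 1/rho = sqrt2 - 1. *)
Lemma silver_residual (e v gap q : R) : 1 <= rho R * e -> 0 <= q -> q <= gap ->
  0 <= ((rho R * e) ^+ 2 - 1) / 2 * (v + Num.sqrt 2 * gap)
       + (1 - e ^+ 2) / 2 * v - e * ((1 + e) * q)
       + rho R * ((rho R * e - e ^+ 2) * q - e ^+ 2 * v).
Proof.
have r2 := sqr_sqrt2; have r1 := sqrt2_gt1.
rewrite /rho; move: (Num.sqrt 2) r2 r1 => r r2 r1 re1 q0 qg.
have e0 : 0 < e by nra.
have ee : r - 1 <= e.
  have -> : r - 1 = (r - 1) * 1 by ring.
  have -> : e = (r - 1) * ((1 + r) * e).
    have -> : (r - 1) * ((1 + r) * e) = (r * r - 1) * e by ring.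
    by rewrite r2; ring.
  by apply: ler_wpM2l => //; lra.
have re2 : 1 <= ((1 + r) * e) ^+ 2 by rewrite expr_ge1 // (le_trans ler01).
have c0 : 0 <= (((1 + r) * e) ^+ 2 - 1) / 2 * r.
  by apply: mulr_ge0; lra.
have p0 : 0 <= q * (r / 2 * e ^+ 2 + (2 + 2 * r) * e - r / 2).
  apply: mulr_ge0 => //.
  have : 0 <= r / 2 * e ^+ 2 by apply: mulr_ge0; [lra | exact: sqr_ge0].
  have : (2 + 2 * r) * (r - 1) <= (2 + 2 * r) * e by apply: ler_wpM2l => //; lra.
  have -> : (2 + 2 * r) * (r - 1) = 2 * (r * r) - 2 by ring.
  rewrite r2. have : r < 2 by nra.
  lra.
have := ler_wpM2l c0 qg.
rewrite -subr_ge0 => H.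
have := addr_ge0 H p0.
congr (_ <= _).
apply/eqP; rewrite -subr_eq0; apply/eqP.
(* The two sides differ by an explicit multiple of r^2 - 2. *)
transitivity ((r * r - 2) * - (q * e + (q * (r + 2) + v) * e ^+ 2 / 2));
  last by rewrite r2 subrr mul0r.
by field.
Qed.

End SilverRatio.

(** * The recursions for [tau], [eta] and [sched] *)

Section Schedule.
Context (R : realType).
Implicit Types k : nat.

Lemma tauS k : (0 < k)%N -> tau R k.+1 =
  2^-1 * (tau R k + 4 * rho R ^+ k
          + Num.sqrt (tau R k ^+ 2 + 8 * rho R ^+ k * tau R k)).
Proof. by case: k. Qed.

Lemma schedS k : (0 < k)%N ->
  sched R k.+1 = sched R k ++ eta R k :: silver R k.
Proof. by case: k. Qed.

Lemma size_sched k : (0 < k)%N -> size (sched R k) = (2 ^ k - 1)%N.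
Proof.
elim: k => // -[|k] IHk _ //.
rewrite schedS // size_cat IHk //= size_mkseq [in RHS]expnS.
have : (0 < 2 ^ k.+1)%N by rewrite expn_gt0.
lia.
Qed.

Lemma tau_ge4 k : (0 < k)%N -> 4 <= tau R k.
Proof.
elim: k => // -[|k] IHk _; first by rewrite /=.
have {IHk} := IHk isT; rewrite (tauS (ltn0Sn _)).
have : 0 <= rho R ^+ k.+1 by rewrite exprn_ge0 // ltW ?rho_gt0.
move: (rho R ^+ k.+1) (tau R k.+1) => a t a0 t4.
have : Num.sqrt (t ^+ 2) <= Num.sqrt (t ^+ 2 + 8 * a * t).
  by apply: ler_wsqrtr; rewrite lerDl !mulr_ge0 //; lra.
by rewrite sqrtr_sqr ger0_norm; lra.
Qed.

Lemma rho_exp_gt2 k : (0 < k)%N -> 2 < rho R ^+ k.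
Proof.
case: k => // k _; rewrite exprS.
have := rho_gt2 R; have : 1 <= rho R ^+ k; last by nra.
by rewrite exprn_ege1 //; have := rho_gt2 R; lra.
Qed.

(** Here [e] is the positive root of 2 e^2 + t e = t a, where t = tau_k and a = rho^k. With S the
    square root in the recursion, the last identity is (t + 4 a)^2 - S^2 = 16 a^2. *)
Lemma eta_facts k (e := eta R k - 1) : (0 < k)%N ->
  [/\ 1 <= e, e < rho R ^+ k,
     2 * e ^+ 2 = tau R k * (rho R ^+ k - e)
   & 2 * rho R ^+ k ^+ 2 = tau R k.+1 * (rho R ^+ k - e)].
Proof.
move=> k0; rewrite tauS // /e /eta addrAC subrr add0r {e}.
have := tau_ge4 k0; have := rho_exp_gt2 k0.
move: (rho R ^+ k) (tau R k) => a t a2 t4.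
have S0 := sqrtr_ge0 (t ^+ 2 + 8 * a * t).
have SS : Num.sqrt (t ^+ 2 + 8 * a * t) * Num.sqrt (t ^+ 2 + 8 * a * t)
  = t ^+ 2 + 8 * a * t by rewrite -expr2 sqr_sqrtr //; nra.
move: (Num.sqrt _) S0 SS => S S0 SS.
have S4 : t + 4 <= S by nra.
have Sa : S < t + 4 * a by nra.
split; [lra | lra | |].
- have -> : 2 * ((S - t) / 4) ^+ 2 = (S * S - 2 * S * t + t ^+ 2) / 8 by field.
  by rewrite SS; field.
- have -> : 2^-1 * (t + 4 * a + S) * (a - (S - t) / 4) =
    ((t + 4 * a) ^+ 2 - S * S) / 8 by field.
  by rewrite SS; field.
Qed.

End Schedule.

(** * Reference points, their potentials and the effect of one step *)

Record reference (R : realType) (d : nat) := Ref {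
  ref_x : 'rV[R]_d; ref_f : R; ref_g : 'rV[R]_d; ref_s : 'rV[R]_d; ref_h : R }.

Section Potential.
Context (R : realType) (d : nat) (x g s : nat -> 'rV[R]_d) (f h : nat -> R).
Hypothesis f_cocoercive : forall i j,
  f j + dot (g j) (x i - x j) + dot (g i - g j) (g i - g j) / 2 <= f i.
Hypothesis h_subgradient : forall i j,
  h j.+1 + dot (s j.+1) (x i - x j.+1) <= h i.

Implicit Types (r : reference R d) (nu : 'rV[R]_d) (a e J D : R).

Definition ref_nu r := ref_g r + ref_s r.
Definition ref_z r := ref_x r - ref_nu r.

(** The h-part is tested at [ref_z], a unit step away from [ref_x], so [ref_h] plays the role of h
    there. It runs over [j.+1] because the starting point need not carry a subgradient. *)
Definition ref_valid r :=
  (forall i, f i + dot (g i) (ref_x r - x i)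
             + dot (g i - ref_g r) (g i - ref_g r) / 2 <= ref_f r) /\
  (forall j, h j.+1 + dot (s j.+1) (ref_z r - x j.+1) <= ref_h r).

(** The quadratic upper model of f at [ref_x], plus h, both taken at [ref_z]. *)
Definition ref_val r :=
  ref_f r + ref_h r - dot (ref_g r) (ref_nu r) + dot (ref_nu r) (ref_nu r) / 2.

Definition ref_pot r i :=
  dot (x i - ref_z r) (x i - ref_z r) / 2 - dot (ref_s r) (x i) + h i.

Definition ref_gap r j :=
  ref_h r - h j - dot (s j) (ref_z r - x j)
  + dot (ref_s r - s j) (ref_s r - s j) / 2.

(** The last field is the value at [x m - nu] of the affine function with slope [nu - g m] that
    equals [h m] at [x m]. *)
Definition iter_ref m nu := Ref (x m) (f m) (g m) (nu - g m)
  (h m - dot (nu - g m) nu).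

Definition pgrad i := g i + s i.+1.

Definition pg_step i a := x i.+1 = x i - a *: pgrad i.

Definition h_gap i a := h i - h i.+1 - a * dot (s i.+1) (pgrad i).

Lemma ref_gap_ge0 r j : ref_valid r -> 0 <= ref_gap r j.+1.
Proof.
move=> [_ /(_ j)]; rewrite /ref_gap.
have := dot_ge0 (ref_s r - s j.+1); lra.
Qed.

Lemma h_gap_ge0 i a : pg_step i a -> 0 <= h_gap i a.
Proof.
by move=> xS; have := h_subgradient i i; rewrite xS subKr /h_gap dotZr; lra.
Qed.

(** This is the subgradient inequality at [x i.+1], tested at the next iterate; hence the index
    shift. *)
Lemma h_gap_le i a : pg_step i.+1 a ->
  h_gap i.+1 a <= a * dot (s i.+1 - s i.+2) (pgrad i.+1).
Proof.
move=> xS; have := h_subgradient i.+2 i; rewrite xS addrAC subrr add0r /h_gap !dotE; lra.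
Qed.

Lemma ref_nu_iter m nu : ref_nu (iter_ref m nu) = nu.
Proof. by rewrite /ref_nu /= addrC subrK. Qed.

Lemma ref_val_iter m nu :
  ref_val (iter_ref m nu) = f m + h m - dot nu nu / 2.
Proof. rewrite /ref_val ref_nu_iter /= !dotE; lra. Qed.

(** Co-coercivity between [x i] and the reference, multiplied by [1 + e]: its slack and the slack of
    the claim are identical as polynomials in inner products. *)
Lemma pg_step_pot i e r : 0 <= 1 + e -> pg_step i (1 + e) -> ref_valid r ->
  ref_pot r i.+1 - ref_pot r i + (1 - e ^+ 2) / 2 * dot (pgrad i) (pgrad i)
    - e * h_gap i (1 + e) + (1 + e) * ref_gap r i.+1
  <= (1 + e) * (ref_val r - ref_val (iter_ref i (pgrad i))).
Proof.
move=> e_ge xS [/(_ i) rf _]; rewrite ref_val_iter.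
rewrite -subr_ge0; move: (ler_wpM2l e_ge rf); rewrite -subr_ge0 => /le_trans.
apply; rewrite le_eqVlt; apply/orP; left; apply/eqP.
rewrite /ref_pot /h_gap /ref_gap /ref_val xS /ref_z /ref_nu /pgrad /=.
case: r {rf} => /= xs fs gs sg c.
move: (g i) (s i.+1) (x i) (f i) (h i) (h i.+1) => gi si xi fi hi hj.
rewrite !dotE (dotC gi xs) (dotC gs xs) (dotC sg xs) (dotC xi xs) (dotC si xs).
rewrite (dotC gs gi) (dotC sg gi) (dotC si gi) (dotC xi gi).
rewrite (dotC gs xi) (dotC sg xi) (dotC si xi).
rewrite (dotC gs si) (dotC sg si) (dotC sg gs) ?(dotC xi sg).
by field.
Qed.

Definition iter_valid m nu := ref_valid (iter_ref m nu).

Definition energy m nu := dot nu nu + Num.sqrt 2 * ref_gap (iter_ref m nu) m.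

Lemma iter_validP m nu :
  (forall j, h j.+1 + dot (s j.+1) (x m - nu - x j.+1) <= h m - dot (nu - g m) nu) ->
  iter_valid m nu.
Proof.
move=> hT; split => [i|j]; last by rewrite /ref_z ref_nu_iter; exact: hT.
by move: (f_cocoercive m i); rewrite /= -[g i - g m]opprB !dotE; lra.
Qed.

Lemma iter_valid0 m : iter_valid m 0.
Proof.
by apply: iter_validP => j; move: (h_subgradient m j); rewrite subr0 dot0r subr0.
Qed.

(* A step of length at least 1 makes x_m - pgrad m a convex combination of x_m
   and x_(m+1). *)
Lemma iter_valid_pgrad m e : 0 <= e -> pg_step m (1 + e) ->
  iter_valid m (pgrad m).
Proof.
move=> e0 xS; apply: iter_validP => j.
have hm := h_subgradient m j; have hS := h_subgradient m.+1 j.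
have -> : pgrad m - g m = s m.+1 by rewrite /pgrad addrAC subrr add0r.
rewrite -(ler_pM2l (_ : 0 < 1 + e)); last by lra.
have := h_gap_ge0 xS; rewrite /h_gap; move: hS; rewrite xS.
move: (ler_wpM2l e0 hm); rewrite !dotE; lra.
Qed.

Lemma ref_gap_iter m nu : ref_gap (iter_ref m nu) m =
  (dot (g m + s m) (g m + s m) - dot nu nu) / 2.
Proof.
rewrite /ref_gap /ref_z ref_nu_iter /= !dotE.
rewrite (dotC (g m) nu) (dotC (s m) nu) (dotC (g m) (s m)); by field.
Qed.

(** * The two block inequalities and how blocks are glued *)

Definition block_bounds b m nu a J D :=
  (forall r, ref_valid r -> J + ref_pot r m - ref_pot r b
     <= (a - 1) * (ref_val r - ref_val (iter_ref m nu))) /\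
  D <= ref_pot (iter_ref m nu) b - ref_pot (iter_ref m nu) m
       + Num.sqrt 2 * ref_gap (iter_ref m nu) b.

(** The claim is an exact sum: the first block bound at a reference placed at [x b], the second
    block bound, co-coercivity of f at [m] tested at [b], and [e] times the same with the roles
    exchanged. *)
Lemma val_increment b m nu a J D e : iter_valid m nu ->
  block_bounds b.+1 m nu a J D -> 0 <= e -> Num.sqrt 2 <= 1 + e ->
  pg_step b (1 + e) ->
  J + D + dot nu nu + (a - e ^+ 2) / (1 + e) * h_gap b (1 + e)
  <= (a - e) * (ref_val (iter_ref b (pgrad b)) - ref_val (iter_ref m nu))
     + e ^+ 2 * dot (pgrad b) (pgrad b).
Proof.
set t := iter_ref m nu => t_valid [pot_val pot_gap] e_ge0 e_ge xS.
have e1 : 0 < 1 + e by lra.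
have e1N : 1 + e != 0 by rewrite gt_eqF.
(* In the h-part the reference averages x_b and x_(b+1) with weights e and 1. *)
pose r := Ref (x b) (f b) (g b) (s b.+1) ((e * h b + h b.+1) / (1 + e)).
have r_valid : ref_valid r.
  rewrite /ref_valid /r; split => [i|j] /=.
    by move: (f_cocoercive b i); rewrite -[g i - g b]opprB !dotE; lra.
  rewrite ler_pdivlMr // mulrC.
  have hb := h_subgradient b j; have hS := h_subgradient b.+1 j.
  rewrite /ref_z /ref_nu /= -/(pgrad b).
  move: hS; rewrite xS; move: (ler_wpM2l e_ge0 hb); rewrite !dotE; lra.
have gap_le : Num.sqrt 2 * ref_gap t b.+1 <= (1 + e) * ref_gap t b.+1.
  by apply: ler_wpM2r => //; exact: ref_gap_ge0.
have potD := le_trans pot_gap (lerD (lexx _) gap_le).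
have fbm := f_cocoercive b m; have := f_cocoercive m b.
move=> /(ler_wpM2l e_ge0) fmb.
have := lerD (lerD (pot_val _ r_valid) potD) (lerD fbm fmb).
rewrite -subr_ge0 => /le_trans H; rewrite -subr_ge0; apply: H.
rewrite le_eqVlt; apply/orP; left; apply/eqP.
rewrite /ref_pot /h_gap /ref_gap /ref_val /ref_z !ref_nu_iter /ref_nu xS /=.
rewrite /pgrad.
move: (g b) (s b.+1) (x b) (f b) (h b) (h b.+1) => gb sb xb fb hb hb1.
move: (g m) (x m) (f m) (h m) => gm xm fm hm.
rewrite !dotE.
rewrite ?(dotC gm gb) ?(dotC nu gb) ?(dotC sb gb) ?(dotC xb gb) ?(dotC xm gb).
rewrite ?(dotC nu gm) ?(dotC sb gm) ?(dotC xb gm) ?(dotC xm gm).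
rewrite ?(dotC sb nu) ?(dotC xb nu) ?(dotC xm nu) ?(dotC xb sb) ?(dotC xm sb).
rewrite ?(dotC xm xb).
by field.
Qed.

(** Put u = s_(n+1) - s_(n+2). Then [h_gap_le] bounds the quotient by <u, v>, while g_(n+1) +
    s_(n+1) = v + u makes the gap equal to <u, v> + |u|^2/2. *)
Lemma h_gap_div n (w : R) (v := pgrad n.+1) : 0 < w -> pg_step n.+1 w ->
  0 <= h_gap n.+1 w / w /\ h_gap n.+1 w / w <= ref_gap (iter_ref n.+1 v) n.+1.
Proof.
move=> w0 xS; split; first by rewrite divr_ge0 ?h_gap_ge0 // ltW.
rewrite ler_pdivrMr // mulrC (le_trans (h_gap_le xS)) // ler_pM2l //.
rewrite ref_gap_iter -/v.
have -> : g n.+1 + s n.+1 = v + (s n.+1 - s n.+2).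
  by rewrite /v /pgrad -addrA [s n.+2 + _]addrC subrK.
have := dot_ge0 (s n.+1 - s n.+2); move: (s n.+1 - s n.+2) => u.
by rewrite dot_sqrD; lra.
Qed.

(** The first block and the middle step compare [r] with the middle iterate [t1], both weighted to a
    + e; [val_increment] times rho compares [t1] with the end [t] with the same weight, so [t1]
    drops out. The second bound is the case r = t, where the value difference vanishes. *)
Lemma block_bounds_glue b n m nu a e D J' D' : iter_valid m nu -> a = rho R * e ->
  1 <= a -> pg_step n.+1 (1 + e) ->
  block_bounds b.+1 n.+1 (pgrad n.+1) a
    ((a ^+ 2 - 1) / 2 * energy n.+1 (pgrad n.+1)) D ->
  block_bounds n.+2 m nu a J' D' ->
  block_bounds b.+1 m nu (rho R * a) (J' + rho R * (J' + D' + dot nu nu))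
    (D' + rho R * (J' + D' + dot nu nu)).
Proof.
move=> t_valid ae a1 xS [pot1 _] B2.
have rho2 := rho_gt2 R; have rr := rho_sqr R; have r2 := sqr_sqrt2 R.
have e0 : 0 < e by rewrite ae in a1; nra.
have e1 : 0 < 1 + e by lra.
(* Since e >= 1/rho, this is 1 + 1/rho = sqrt2, the shortest silver step. *)
have e_sqrt : Num.sqrt 2 <= 1 + e.
  by rewrite ae /rho in a1; have := sqrt2_gt1 R; nra.
have I := val_increment t_valid B2 (ltW e0) e_sqrt xS.
have {B2} [pot2 gap2] := B2.
set t := iter_ref m nu in t_valid pot2 gap2 I *.
set v := pgrad n.+1 in pot1 I *.
set t1 := iter_ref n.+1 v in pot1 I *.
pose q := h_gap n.+1 (1 + e) / (1 + e).
have qE : h_gap n.+1 (1 + e) = (1 + e) * q by rewrite /q mulrC divfK ?gt_eqF.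
have := h_gap_div e1 xS; rewrite -/q -/v -/t1 => -[q0 qgap].
have re1 : 1 <= rho R * e by rewrite -ae.
have := silver_residual (dot v v) re1 q0 qgap; rewrite -ae => res.
have coef : rho R * a = 2 * a + e by rewrite ae mulrA rr; ring.
(* Multiplication by rho turns the weight a - e into a + e. *)
have I' : rho R * (J' + D' + dot nu nu) + rho R * ((a - e ^+ 2) * q)
  <= (a + e) * (ref_val t1 - ref_val t) + rho R * (e ^+ 2 * dot v v).
  have <- : rho R * (a - e) = a + e by rewrite mulrBr coef ae; ring.
  have := ler_wpM2l (ltW (lt_trans (ltr0n _ 2) rho2)) I.
  rewrite qE mulrA divfK ?gt_eqF //; lra.
move: (rho R * (J' + D' + dot nu nu)) I' => i I'.
rewrite coef; move: res; rewrite /energy -/t1; move=> res.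
have glue r : ref_valid r -> ref_pot r n.+2 - ref_pot r b.+1 + (1 + e) * ref_gap r n.+2
  + i <= (a + e) * (ref_val r - ref_val t).
  move=> r_valid; have := pot1 _ r_valid; have := pg_step_pot (ltW e1) xS r_valid.
  rewrite qE /energy -/v -/t1; move: I' res; lra.
split=> [r r_valid|].
  have := glue _ r_valid; have := pot2 _ r_valid.
  have := mulr_ge0 (ltW e1) (ref_gap_ge0 n.+1 r_valid); lra.
have := glue _ t_valid; rewrite subrr mulr0.
have := ler_wpM2r (ref_gap_ge0 n.+1 t_valid) e_sqrt.
have := mulr_ge0 (ltW (lt_trans ltr01 (sqrt2_gt1 R))) (ref_gap_ge0 b t_valid).
move: gap2; lra.
Qed.

Lemma block_bounds1 b nu :
  block_bounds b b nu 1 0 (energy b nu - dot nu nu).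
Proof.
split=> [r _|]; first by rewrite add0r !subrr mul0r.
by rewrite /energy addrC addKr subrr add0r.
Qed.

(** * Silver blocks and the full schedule *)

Definition silver_block b k := forall i, (i < 2 ^ k - 1)%N ->
  pg_step (b + i) (1 + rho R ^ ((logn 2 i.+1)%:Z - 1)).

Lemma silver_blockS b k : silver_block b k.+1 ->
  [/\ silver_block b k, pg_step (b + (2 ^ k).-1) (1 + rho R ^+ k / rho R)
    & silver_block (b + 2 ^ k) k].
Proof.
move=> B; have k2 : (0 < 2 ^ k)%N by rewrite expn_gt0.
split=> [i ik||i ik].
- by apply: B; rewrite expnS; lia.
- have := B (2 ^ k).-1; rewrite prednK // pfactorK // expfzDr ?rho_neq0 //.
  by rewrite -exprnP; apply; rewrite expnS; lia.
- have := B (2 ^ k + i)%N; rewrite addnA -addnS logn_expD //; last by lia.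
  by apply; rewrite expnS; lia.
Qed.

(** Gluing adds rho (J + D + |nu|^2) = rho a^2 E to both constants, and 1 + 2 rho = rho^2 turns a^2
    into (rho a)^2. A block starts at [b.+1] and ends at [b + 2 ^ k], so all its points have
    subgradients. *)
Lemma silver_block_bounds k b nu : silver_block b.+1 k ->
  iter_valid (b + 2 ^ k) nu ->
  block_bounds b.+1 (b + 2 ^ k) nu (rho R ^+ k)
    ((rho R ^+ k ^+ 2 - 1) / 2 * energy (b + 2 ^ k) nu)
    ((rho R ^+ k ^+ 2 + 1) / 2 * energy (b + 2 ^ k) nu - dot nu nu).
Proof.
elim: k b nu => [|k IHk] b nu.
  move=> _ _; rewrite expn0 addn1 !expr0 expr1n subrr !mul0r.
  have -> : (1 + 1) / 2 = 1 :> R by field.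
  by rewrite mul1r; exact: block_bounds1.
case/silver_blockS => B1 xS B2 t_valid.
have k2 : (0 < 2 ^ k)%N by rewrite expn_gt0.
have nE : (b.+1 + (2 ^ k).-1 = b + 2 ^ k)%N by lia.
rewrite nE in xS.
have mE : (b + 2 ^ k.+1 = b + 2 ^ k + 2 ^ k)%N by rewrite expnS; lia.
rewrite mE in t_valid *.
have a1 : 1 <= rho R ^+ k by rewrite exprn_ege1 //; have := rho_gt2 R; lra.
have ae : rho R ^+ k = rho R * (rho R ^+ k / rho R) by rewrite mulrC divfK ?rho_neq0.
have e0 : 0 <= rho R ^+ k / rho R by rewrite divr_ge0 ?exprn_ge0 ?ltW ?rho_gt0.
have n_valid := iter_valid_pgrad e0 xS.
(* The gluing lemma needs the middle index as a successor, since it uses the subgradient there. *)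
have nS : (b + 2 ^ k = (b + 2 ^ k).-1.+1)%N by lia.
have B1' := IHk b _ B1 n_valid.
have B2' := IHk (b + 2 ^ k)%N nu B2 t_valid.
rewrite nS in xS B1'.
rewrite [in X in block_bounds X]nS in B2'.
have := block_bounds_glue t_valid ae a1 xS B1' B2'.
rewrite [rho R ^+ k.+1]exprS; move: (rho R ^+ k) => a.
have rr := rho_sqr R.
have -> : (a ^+ 2 - 1) / 2 * energy (b + 2 ^ k + 2 ^ k) nu + rho R *
    ((a ^+ 2 - 1) / 2 * energy (b + 2 ^ k + 2 ^ k) nu +
     ((a ^+ 2 + 1) / 2 * energy (b + 2 ^ k + 2 ^ k) nu - dot nu nu)
     + dot nu nu)
   = ((rho R * a) ^+ 2 - 1) / 2 * energy (b + 2 ^ k + 2 ^ k) nu.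
  by rewrite exprMn [rho R ^+ 2]expr2 rr; field.
have -> : (a ^+ 2 + 1) / 2 * energy (b + 2 ^ k + 2 ^ k) nu - dot nu nu + rho R *
    ((a ^+ 2 - 1) / 2 * energy (b + 2 ^ k + 2 ^ k) nu +
     ((a ^+ 2 + 1) / 2 * energy (b + 2 ^ k + 2 ^ k) nu - dot nu nu)
     + dot nu nu)
   = ((rho R * a) ^+ 2 + 1) / 2 * energy (b + 2 ^ k + 2 ^ k) nu - dot nu nu.
  by rewrite exprMn [rho R ^+ 2]expr2 rr; field.
by [].
Qed.

(** Write g + s = nu + w at the iterate; validity tested at the iterate itself says <w, nu> >= 0. *)
Lemma iter_valid_dot_le m nu : iter_valid m.+1 nu ->
  dot nu nu <= dot (g m.+1 + s m.+1) (g m.+1 + s m.+1).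
Proof.
move=> [_ /(_ m)]; rewrite /ref_z ref_nu_iter /=.
have -> : g m.+1 + s m.+1 = nu + (s m.+1 - (nu - g m.+1)).
  by rewrite opprB addrCA [nu + _]addrC subrK addrC.
have -> : x m.+1 - nu - x m.+1 = - nu by rewrite addrAC subrr add0r.
have := dot_ge0 (s m.+1 - (nu - g m.+1)).
have : dot (s m.+1 - (nu - g m.+1)) nu = dot (s m.+1) nu - dot (nu - g m.+1) nu.
  by rewrite dotDl dotNl.
by move: (s m.+1 - _) => w; rewrite dot_sqrD dotNr; lra.
Qed.

(** As sqrt2 < 3/2 and |nu| <= |g_1 + s_1|, it suffices that 3/2 |g_1 + s_1|^2 is at most the
    decrease of F. Co-coercivity at 1 tested at 0 (twice), the reverse one and the subgradient
    inequality add up to exactly this. *)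
Lemma sched_bound1 nu : pg_step 0 (3 / 2) -> iter_valid 1 nu ->
  tau R 1 / 2 * energy 1 nu <= f 0 + h 0 - ref_val (iter_ref 1 nu).
Proof.
move=> xS nu_valid; have uv := iter_valid_dot_le nu_valid.
rewrite ref_val_iter /energy ref_gap_iter /=.
have r32 := sqrt2_lt32 R.
have := f_cocoercive 1 0; have := f_cocoercive 0 1; have := h_subgradient 0 0.
rewrite xS subKr.
have -> : x 0 - 3 / 2 *: pgrad 0 - x 0 = - (3 / 2 *: pgrad 0).
  by rewrite addrAC subrr add0r.
have : 0 <= (3 / 2 - Num.sqrt 2) * (dot (g 1%N + s 1%N) (g 1%N + s 1%N) - dot nu nu).
  by apply: mulr_ge0; lra.
rewrite /pgrad; move: (g 0) (g 1%N) (s 1%N) => g0 g1 s1.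
rewrite !dotE (dotC g1 g0) (dotC s1 g0) (dotC s1 g1).
lra.
Qed.

Lemma sched_bound k nu : (0 < k)%N ->
  (forall i, (i < 2 ^ k - 1)%N -> pg_step i (nth 0 (sched R k) i)) ->
  iter_valid (2 ^ k - 1) nu ->
  tau R k / 2 * energy (2 ^ k - 1) nu
  <= f 0 + h 0 - ref_val (iter_ref (2 ^ k - 1) nu).
Proof.
elim: k nu => // -[_ nu _ B|k IHk nu _ B].
  by apply: sched_bound1; exact: (B 0).
have k2 : (0 < 2 ^ k)%N by rewrite expn_gt0.
have nS : (2 ^ k.+1 - 1 = (2 ^ k.+1).-2.+1)%N by rewrite expnS; lia.
have sz := size_sched R (ltn0Sn k).
have mE : (2 ^ k.+2 - 1 = (2 ^ k.+1 - 1) + 2 ^ k.+1)%N by rewrite !expnS; lia.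
have xn : pg_step (2 ^ k.+1 - 1) (eta R k.+1).
  have := B (2 ^ k.+1 - 1)%N; rewrite schedS // nth_cat sz ltnn subnn; apply.
  by rewrite !expnS; lia.
have B2 : silver_block (2 ^ k.+1 - 1).+1 k.+1.
  move=> i ik; have := B ((2 ^ k.+1 - 1).+1 + i)%N.
  rewrite addSnnS schedS // nth_cat sz.
  rewrite [(_ + i.+1 < 2 ^ k.+1 - 1)%N]ltnNge leq_addr addKn /= nth_mkseq //.
  apply.
  by move: ik; rewrite !expnS; lia.
rewrite mE => nu_valid.
have [e1 ea tauE tauSE] := eta_facts R (ltn0Sn k).
have etaE : eta R k.+1 = 1 + (eta R k.+1 - 1) by rewrite addrC subrK.
rewrite etaE in xn; move: (eta R k.+1 - 1) xn e1 ea tauE tauSE => e xn e1 ea tauE tauSE.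
have e0 : 0 <= e by lra.
have n_valid := iter_valid_pgrad e0 xn.
have B1 i : (i < 2 ^ k.+1 - 1)%N -> pg_step i (nth 0 (sched R k.+1) i).
  move=> ik; have := B i; rewrite schedS // nth_cat sz ik; apply.
  by move: ik; rewrite !expnS; lia.
have {IHk} IH := IHk _ isT B1 n_valid.
have bnd := silver_block_bounds B2 nu_valid.
have r32 := sqrt2_lt32 R.
have e_sqrt : Num.sqrt 2 <= 1 + e by lra.
have I := val_increment nu_valid bnd e0 e_sqrt xn.
have xn' : pg_step (2 ^ k.+1).-2.+1 (1 + e) by rewrite -nS.
have := h_gap_div (_ : 0 < 1 + e) xn'; rewrite -nS => -[|q0 qgap]; first by lra.
move: IH I q0 qgap; rewrite [_ / (1 + e) * _]mulrAC -[_ * _ / (1 + e)]mulrA.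
rewrite [energy (2 ^ k.+1 - 1) _]/energy.
move: (2 ^ k.+1 - 1)%N => n.
move: (h_gap n (1 + e) / _) (ref_gap _ n) (ref_val (iter_ref n _)) => q gap Pn.
move: (ref_val _) (energy _ nu) (dot (pgrad n) _) (f 0 + h 0) (dot nu nu).
move=> Pm E v F0 nn IH I q0 qgap.
have ae : 0 < rho R ^+ k.+1 - e by rewrite subr_gt0.
(* Multiplied by a - e, the induction hypothesis has e^2 E_n on the left, which absorbs the term e^2
   |pgrad|^2 of [I]. *)
rewrite -(ler_pM2l ae); have := ler_wpM2l (ltW ae) IH.
have scale (t y z : R) : 2 * z = t * (rho R ^+ k.+1 - e) ->
  (rho R ^+ k.+1 - e) * (t / 2 * y) = z * y.
  move=> tz; have -> : z = t * (rho R ^+ k.+1 - e) / 2 by rewrite -tz; field.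
  by field.
rewrite (scale _ _ _ tauSE) (scale _ _ _ tauE).
(* What remains is (a - e^2) q + sqrt2 e^2 gap, nonnegative because 0 <= q <= gap. *)
have := mulr_ge0 (ltW (lt_trans (lt_le_trans ltr01 e1) ea)) q0.
have := ler_wpM2l (sqr_ge0 e) qgap.
have := mulr_ge0 (mulr_ge0 (sqr_ge0 e) (le_trans q0 qgap))
  (ltW (_ : 0 < Num.sqrt 2 - 1 :> R)).
rewrite subr_gt0 sqrt2_gt1 => /(_ isT).
move: I; move: (rho R ^+ k.+1) => b; lra.
Qed.

Lemma sched_rate k (n := (2 ^ k - 1)%N) (u := g n + s n) : (0 < k)%N ->
  (forall i, (i < n)%N -> pg_step i (nth 0 (sched R k) i)) ->
  dot u u <= 2 * Num.sqrt 2 / tau R k * (f 0 + h 0 - (f n + h n)).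
Proof.
move=> k0 B; have := sched_bound k0 B (iter_valid0 _).
rewrite ref_val_iter /energy ref_gap_iter dot0l mul0r !subr0 add0r -/u.
have t0 : 0 < tau R k by apply: lt_le_trans (tau_ge4 R k0).
rewrite [_ / tau R k * _]mulrAC ler_pdivlMr //.
have := sqr_sqrt2 R; have := sqrt2_gt1 R.
move: (Num.sqrt 2) (tau R k) (dot u u) (_ - _) => r t uu G r1 rr H.
have := ler_wpM2l (ltW (lt_trans ltr01 r1)) H.
have -> : r * (t / 2 * (r * (uu / 2))) = r * r * (t * uu) / 4 by field.
rewrite rr; lra.
Qed.

End Potential.

(** The nonempty sublevel sets within [K] form a filter base; a cluster point lies in each of them
    because they are closed. *)
Lemma compact_min_closed_sublevel (R : realType) (T : topologicalType)
    (K : set T) (q : T -> \bar R) : compact K ->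
  (forall a : R, closed [set z | (q z <= a%:E)%E]) ->
  (forall z, q z != -oo%E) -> (exists2 z, K z & (q z < +oo)%E) ->
  exists2 z, K z & forall y, K y -> (q z <= q y)%E.
Proof.
move=> cK cq qNoo [z0 Kz0 qz0].
pose D := [set a : R | exists2 y, K y & (q y <= a%:E)%E].
pose B (a : R) := K `&` [set z | (q z <= a%:E)%E].
have DP y : K y -> (q y < +oo)%E -> D (fine (q y)).
  move=> Ky qy; exists y => //.
  by case: (q y) qy (qNoo y).
have BF : Filter (filter_from D B).
  apply: filter_from_filter; first by exists (fine (q z0)); exact: DP.
  move=> a b Da Db; exists (Num.min a b); first by rewrite /Num.min; case: ifP.
  move=> z [Kz]; rewrite /B /= EFin_min le_min => /andP[qa qb].
  by split; split.
have PF : ProperFilter (filter_from D B).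
  by apply: filter_from_proper => a [y Ky qy]; exists y.
have [|z [Kz zcl]] := cK _ PF.
  by exists (fine (q z0)); [exact: DP | move=> z []].
exists z => // y Ky.
case qy : (q y) => [r| |]; [|by rewrite leey|by have := qNoo y; rewrite qy].
suff : [set z | (q z <= r%:E)%E] z by [].
apply: cq; rewrite clusterE in zcl.
apply: zcl; exists r; last by move=> t [].
by exists y => //; rewrite qy.
Qed.

Lemma ler_addMsmall (R : realFieldType) (a b c : R) :
  (forall t, 0 < t <= 1 -> a <= b + t * c) -> a <= b.
Proof.
move=> abc; apply/ler_addgt0Pl => e e0.
have c1 : 0 < `|c| + 1 by rewrite ltr_wpDl.
pose t := Num.min 1 (e / (`|c| + 1)).
have t0 : 0 < t by rewrite lt_min ltr01 divr_gt0.
apply: (le_trans (abc t _)); first by rewrite t0 ge_min lexx.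
rewrite addrC lerD2r; apply: (@le_trans _ _ (t * (`|c| + 1))).
  by rewrite ler_pM2l // (le_trans (ler_norm _)) // lerDl.
by rewrite -ler_pdivlMr // ge_min lexx orbT.
Qed.

(** * Co-coercivity of the gradient of a smooth convex function *)

Section SmoothConvex.
Context (R : realType) (d : nat) (f : 'rV[R]_d -> R).
Hypothesis f_convex : convex_function [set: 'rV[R]_d] f.
Hypothesis f_smooth : smooth1 f.
Implicit Types (x y v : 'rV[R]_d).

Lemma derive_gradient x v : 'D_v f x = dot (gradient f x) v.
Proof.
have fx : differentiable f x by exact: f_smooth.1.
rewrite deriveE // {1}[v]row_sum_delta linear_sum.
apply: eq_bigr => i _; rewrite linearZ /= mxE deriveE // mulrC.
by [].
Qed.

Lemma is_derive_line x v (t : R) :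
  is_derive t (1 : R) (fun t : R => f (x + t *: v)) (dot (gradient f (x + t *: v)) v).
Proof.
have E : (fun h : R => h^-1 *: (f (x + (h *: (1 : R) + t) *: v) - f (x + t *: v)))
  = (fun h : R => h^-1 *: (f (h *: v + (x + t *: v)) - f (x + t *: v))).
  by apply/funext => h; rewrite [h *: 1]mulr1 scalerDl addrCA.
split; last first.
  by rewrite -derive_gradient /derive E.
rewrite /derivable E.
by apply: diff_derivable; exact: f_smooth.1.
Qed.

Lemma dot_gradient_le x v (t : R) : 0 <= t ->
  `|dot (gradient f (x + t *: v) - gradient f x) v| <= t * dot v v.
Proof.
rewrite le_eqVlt => /predU1P[<-|t0].
  by rewrite scale0r addr0 subrr dot0l normr0 mul0r.
have := f_smooth.2 (x + t *: v) x; rewrite addrAC subrr add0r /enorm.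
rewrite ler_psqrt ?nnegrE ?dot_ge0 //.
move: (_ - gradient f x) => a; rewrite !dotE => av.
(* Cauchy-Schwarz and the Lipschitz bound at once: expand |a - t v|^2 and |a + t v|^2 using |a|^2 <=
   t^2 |v|^2. *)
have := dot_ge0 (a - t *: v); have := dot_ge0 (a + t *: v).
rewrite !dotE (dotC v a) => p1 p2.
by rewrite ler_norml; apply/andP; split; rewrite -(ler_pM2l t0); lra.
Qed.

Lemma convex_line x v (t : R) : 0 <= t <= 1 ->
  f (x + t *: v) <= f x + t * (f (x + v) - f x).
Proof.
move=> /andP[t0 t1].
have := f_convex (Itv01 t0 t1) (in_setT (x + v)) (in_setT x).
have -> : conv (Itv01 t0 t1) (x + v : convex_lmodType _) x = x + t *: v.
  by rewrite /conv /= /unstable.onem scalerDr scalerBl scale1r addrC addrA subrK.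
rewrite convRE /= /unstable.onem => /le_trans; apply.
rewrite le_eqVlt; apply/orP; left; apply/eqP; ring.
Qed.

Lemma MVT_line x v (t : R) : 0 < t -> exists2 c, 0 < c < t &
  f (x + t *: v) - f x = t * dot (gradient f (x + c *: v)) v.
Proof.
move=> t0.
have [||c] := @MVT R (fun s : R => f (x + s *: v))
  (fun s => dot (gradient f (x + s *: v)) v) 0 t t0.
- by move=> s _; exact: is_derive_line.
- by apply: derivable_within_continuous => s _; case: (is_derive_line x v s).
by rewrite in_itv /= scale0r addr0 subr0 => ct ->; exists c => //; rewrite mulrC.
Qed.

(** The mean value theorem on [0, t] gives a slope at some c < t, within t |v|^2 of the slope at 0;
    then t tends to 0. *)
Lemma gradient_le x y : f x + dot (gradient f x) (y - x) <= f y.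
Proof.
set v := y - x.
have -> : y = x + v by rewrite addrC subrK.
apply: (@ler_addMsmall _ _ _ (dot v v)) => t /andP[t0 t1].
have [c /andP[c0 ct] cE] := MVT_line x v t0.
have t01 : 0 <= t <= 1 by rewrite ltW.
have := convex_line x v t01; rewrite -lerBlDl cE ler_pM2l //.
have := dot_gradient_le x v (ltW c0); rewrite ler_norml dotDl dotNl => /andP[+ _].
have : c * dot v v <= t * dot v v by rewrite ler_wpM2r ?dot_ge0 // ltW.
lra.
Qed.

Lemma descent x v :
  f (x + v) <= f x + dot (gradient f x) v + dot v v / 2.
Proof.
pose a := dot (gradient f x) v.
(* The quadratic is chosen so that the derivative of [psi] is nonpositive for s >= 0; the mean value
   theorem then replaces integration. *)
pose psi := (fun s : R => f (x + s *: v))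
  - (a \*: @id R + (dot v v / 2) \*: (@id R) ^+ 2).
have psiE s : psi s = f (x + s *: v) - (a * s + dot v v / 2 * s ^+ 2).
  by rewrite /psi /= exprfctE.
have dP s : is_derive s (1 : R) psi
    (dot (gradient f (x + s *: v)) v - (a + dot v v * s)).
  have H1 := is_derive_line x v s.
  rewrite /psi; apply: is_derive_eq.
  congr (_ - (_ + _)); first by rewrite [LHS]mulr1.
  by rewrite -[LHS]/(dot v v / 2 * (2 * s ^+ 1 * 1)); field.
have [|c] := @MVT R psi _ 0 1 ltr01 (fun s _ => dP s).
  by apply: derivable_within_continuous => s _; case: (dP s).
rewrite in_itv /= => /andP[c0 _].
have := dot_gradient_le x v (ltW c0); rewrite ler_norml dotDl dotNl -/a => /andP[_ +].
rewrite !psiE scale0r scale1r addr0; lra.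
Qed.

(** Evaluate at [x - w] both the tangent at [y], from below, and the descent bound from [x], from
    above. *)
Lemma gradient_cocoercive x y :
  f y + dot (gradient f y) (x - y)
    + dot (gradient f x - gradient f y) (gradient f x - gradient f y) / 2 <= f x.
Proof.
set w := gradient f x - gradient f y.
have := gradient_le y (x - w); have := descent x (- w).
have -> : x - w - y = x - y - w by rewrite addrAC.
rewrite (dotDr _ (x - y)) !dotNr dotNl opprK.
have -> : dot w w = dot (gradient f x) w - dot (gradient f y) w.
  by rewrite -dotNl -dotDl.
lra.
Qed.

End SmoothConvex.

(** * Existence of the proximal point and its optimality condition *)

Section Prox.
Context (R : realType) (d : nat) (h : 'rV[R]_d -> \bar R).
Hypothesis h_proper : proper_fun h.
Hypothesis h_closed : closed_fun h.
Hypothesis h_convex : econvex_fun h.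
Implicit Types (x y z : 'rV[R]_d).

Lemma enorm_sqr x : enorm x ^+ 2 = dot x x.
Proof. by rewrite sqr_sqrtr ?dot_ge0. Qed.

Lemma sqr_norm_le_dot x : `|x| ^+ 2 <= dot x x.
Proof.
rewrite -enorm_sqr ler_pXn2r ?nnegrE ?sqrtr_ge0 //.
rewrite [`|x|]mx_normrE; apply: bigmax_le; first exact: sqrtr_ge0.
move=> [i j] _ /=; rewrite ord1 -sqrtr_sqr ler_wsqrtr //.
rewrite /dot (bigD1 j) //= expr2 lerDl; apply: sumr_ge0 => k _.
by rewrite -expr2 sqr_ge0.
Qed.

Lemma dot_sub_continuous x : continuous (fun z => dot (z - x) (z - x)).
Proof.
move=> z; rewrite /dot; apply: cvg_big => [| |i _].
- exact: add_continuous.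
- exact: nbhs_filter.
have c : (fun y : 'rV[R]_d => (y - x) 0 i) @ z --> (z - x) 0 i.
  apply: (@continuous_comp _ _ _ (fun y => y - x) (fun y : 'rV[R]_d => y 0 i)).
    exact: (cvgB (@cvg_id _ _) (@cvg_cst _ x _ _ _)).
  exact: coord_continuous.
exact: (cvgM c c).
Qed.

Lemma closed_sublevel (c : 'rV[R]_d -> R) : continuous c ->
  closed [set z | (h z <= (c z)%:E)%E].
Proof.
move=> cc.
rewrite -[X in closed X]/((fun z => (z, c z)) @^-1` epigraph h).
apply: preimage_closed => // z _.
exact: (cvg_pair (@cvg_id _ (nbhs z)) (cc z)).
Qed.

Lemma fine_proper y : (h y < +oo)%E -> h y = (fine (h y))%:E.
Proof. by have := h_proper.1 y; case: (h y). Qed.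

Lemma closed_ball_compact x (M : R) : compact [set z : 'rV[R]_d | `|z - x| <= M].
Proof.
apply: bounded_closed_compact.
  exists (M + `|x|); split; first exact: num_real.
  move=> N MN z /= zx; rewrite -[z](subrK x) (le_trans (ler_normD _ _)) //.
  by rewrite (le_trans _ (ltW MN)) // lerD2r.
have := @closed_closed_ball_ R _ x M.
by congr closed; apply/seteqP; split => z /=; rewrite distrC.
Qed.

(** Convexity along the segment from [x0] to [z], at distance 1 from [x0], against the minimum of h
    on the unit ball. This limits the decrease of h to linear, so the quadratic term of the prox
    objective wins. *)
Lemma linear_minorant x0 (c0 : R) : h x0 = c0%:E ->
  exists D : R, 0 <= D /\
    forall z, 1 < `|z - x0| -> ((c0 - `|z - x0| * D)%:E <= h z)%E.
Proof.
move=> hx0.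
have [a|||y /= Ky ymin] :=
    compact_min_closed_sublevel (@closed_ball_compact x0 1) (q := h).
- by apply: closed_sublevel; exact: cst_continuous.
- exact: h_proper.1.
- by exists x0; rewrite /= ?subrr ?normr0 ?hx0 ?ltry.
have hy : h y = (fine (h y))%:E.
  apply: fine_proper; apply: (@le_lt_trans _ _ (h x0)); last by rewrite hx0 ltry.
  by apply: ymin; rewrite /= subrr normr0.
move: (fine (h y)) hy => m hy; exists (c0 - m); split.
  by rewrite subr_ge0 -lee_fin -hy -hx0; apply: ymin; rewrite /= subrr normr0.
move=> z z1.
have [hz|hz] := eqVneq (h z) +oo%E; first by rewrite hz leey.
have {}hz : h z = (fine (h z))%:E by apply: fine_proper; rewrite ltey.
move: (fine (h z)) hz => hz' hz.
have r0 : 0 < `|z - x0| by exact: lt_trans z1.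
have t01 : 0 <= `|z - x0|^-1 <= 1.
  by rewrite invr_ge0 (ltW r0) invf_le1 // ltW.
have := h_convex z x0 t01; rewrite hz hx0 -!EFinM -EFinD => hp.
have := ymin (`|z - x0|^-1 *: z + (1 - `|z - x0|^-1) *: x0).
rewrite hy => /(_ _)/le_trans/(_ hp); rewrite lee_fin => H.
rewrite lee_fin -subr_ge0.
have {H} : m <= `|z - x0|^-1 * hz' + (1 - `|z - x0|^-1) * c0.
  apply: H => /=; rewrite scalerBl scale1r addrCA [x0 + _]addrC addrK.
  by rewrite -scalerBr normrZ normfV normr_id mulVf ?gt_eqF.
rewrite -(ler_pM2l r0) mulrDr mulrA mulfV ?gt_eqF // mul1r mulrA mulrBr mulr1.
by rewrite mulfV ?gt_eqF //; lra.
Qed.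

Lemma prox_argmin (a : R) x : 0 < a -> argmin (prox_obj a h x) (prox a h x).
Proof.
move=> a0; apply: xgetPex.
have [x0 hx0] := h_proper.2; have := fine_proper hx0; move: (fine _) => c0 {}hx0.
have [D [D0 hD]] := linear_minorant hx0.
pose e0 := dot (x0 - x) (x0 - x).
pose r0 := `|x0 - x|.
(* Outside radius [M] the objective is at least its value at [x0]; the summand 1 makes
   [linear_minorant] applicable there. *)
pose M := 2 * (r0 + a * D) + 1 + e0.
have e00 : 0 <= e0 by exact: dot_ge0.
have r00 : 0 <= r0 by exact: normr_ge0.
have aD0 : 0 <= a * D by rewrite mulr_ge0 // ltW.
have q0 : prox_obj a h x x0 = (a * c0 + e0 / 2)%:E.
  by rewrite /prox_obj hx0 enorm_sqr -EFinM -EFinD [2^-1 * _]mulrC.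
have qE z : (h z < +oo)%E ->
    prox_obj a h x z = (a * fine (h z) + dot (z - x) (z - x) / 2)%:E.
  move=> hz; rewrite /prox_obj {1}(fine_proper hz) enorm_sqr -EFinM -EFinD.
  by rewrite [2^-1 * _]mulrC.
have qNoo z : h z = +oo%E -> prox_obj a h x z = +oo%E.
  by move=> hz; rewrite /prox_obj hz gt0_muley ?lte_fin.
have qfin z : (h z < +oo)%E \/ h z = +oo%E.
  by have [|?] := eqVneq (h z) +oo%E; [right | left; rewrite ltey].
have hE z c : (h z < +oo)%E -> (h z <= c%:E)%E = (fine (h z) <= c).
  by move=> hz; rewrite -lee_fin -fine_proper.
have q_closed b : closed [set z | (prox_obj a h x z <= b%:E)%E].
  have -> : [set z | (prox_obj a h x z <= b%:E)%E] =
      [set z | (h z <= (a^-1 * (b - 2^-1 * dot (z - x) (z - x)))%:E)%E].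
    apply/seteqP; split=> z /=; have [hz|hz] := qfin z.
    - by rewrite qE // hE // lee_fin -(ler_pM2l a0 (fine _)) mulVKf ?gt_eqF //; lra.
    - by rewrite qNoo.
    - by rewrite qE // hE // lee_fin -(ler_pM2l a0 (fine _)) mulVKf ?gt_eqF //; lra.
    - by rewrite hz.
  apply: closed_sublevel => z.
  have cst (c : R) : (fun _ : 'rV[R]_d => c) @ z --> c by exact: (@cst_continuous _ _ c z).
  exact: (cvgM (cst a^-1)
    (cvgB (cst b) (cvgM (cst 2^-1) (@dot_sub_continuous x z)))).
have [a'|||z /= Kz zmin] :=
    compact_min_closed_sublevel (@closed_ball_compact x0 M) (q := prox_obj a h x).
- exact: q_closed.
- by move=> z; have [hz|hz] := qfin z; [rewrite qE | rewrite qNoo].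
- exists x0; rewrite /= ?q0 ?ltry // subrr normr0 /M; lra.
exists z => y; have [yK|yK] := leP `|y - x0| M; first exact: zmin.
have [hy|hy] := qfin y; last by rewrite (qNoo y) ?leey.
apply: (@le_trans _ _ (prox_obj a h x x0)).
  by apply: zmin; rewrite subrr normr0 /M; lra.
have y1 : 1 < `|y - x0| by rewrite (le_lt_trans _ yK) // /M; lra.
rewrite q0 qE // lee_fin.
have := hD y y1; rewrite (fine_proper hy) lee_fin => hDy.
have {}hDy := ler_wpM2l (ltW a0) hDy.
have tri : `|y - x0| <= `|y - x| + r0.
  by rewrite /r0 [`|x0 - x|]distrC ler_distD.
have := sqr_norm_le_dot (y - x).
move: hDy yK tri {y1 hy hD hE qE q0}; rewrite /M.
move: `|y - x0| `|y - x| (dot _ _) (fine _) => r u qy hz hDy rM ur uq.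
have rr : r * (1 + e0) <= r * (r - 2 * (r0 + a * D)).
  by apply: ler_wpM2l; lra.
have re : 0 <= (r - 1) * e0 by apply: mulr_ge0 => //; lra.
have ru : (r - r0) ^+ 2 <= u ^+ 2 by rewrite ler_pXn2r // ?nnegrE; lra.
by have := sqr_ge0 r0; rewrite /=; lra.
Qed.

(** Compare [z] with [z + t (y - z)], divide by [t] and let [t] tend to 0. *)
Lemma prox_subgradient (a : R) x z : 0 < a -> argmin (prox_obj a h x) z ->
  (h z < +oo)%E /\ subdifferential h z (a^-1 *: (x - z)).
Proof.
move=> a0 zmin.
have qE y : (h y < +oo)%E ->
    prox_obj a h x y = (a * fine (h y) + dot (y - x) (y - x) / 2)%:E.
  move=> hy; rewrite /prox_obj {1}(fine_proper hy) enorm_sqr -EFinM -EFinD.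
  by rewrite [2^-1 * _]mulrC.
have hz : (h z < +oo)%E.
  have [x0 hx0] := h_proper.2; have := zmin x0; rewrite (qE x0) //.
  rewrite ltey; apply: contraTN => /eqP hz.
  by rewrite /prox_obj hz gt0_muley ?lte_fin.
split=> // y; have [->|hy] := eqVneq (h y) +oo%E; first by rewrite leey.
have {}hy : (h y < +oo)%E by rewrite ltey.
rewrite (fine_proper hz) (fine_proper hy) -EFinD lee_fin dotZl.
rewrite -(ler_pM2l a0) mulrDr mulVKf ?gt_eqF //.
apply: (@ler_addMsmall _ _ _ (dot (y - z) (y - z) / 2)) => t /andP[t0 t1].
have t01 : 0 <= t <= 1 by rewrite ltW.
have hp := h_convex y z t01.
rewrite (fine_proper hz) (fine_proper hy) -!EFinM -EFinD in hp.
have hp' := le_lt_trans hp (ltry _).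
rewrite (fine_proper hp') lee_fin in hp.
have := zmin (t *: y + (1 - t) *: z); rewrite !qE // lee_fin.
have -> : t *: y + (1 - t) *: z - x = (z - x) + t *: (y - z).
  by rewrite scalerBl scale1r scalerBr addrCA addrAC.
rewrite (dot_sqrD (z - x)) dotZl dotZl dotZr -[x - z]opprB dotNl (dotC (y - z)).
have := ler_wpM2l (ltW a0) hp; move: (dot _ (y - z)) => p.
move: (fine (h (_ + _))) (fine (h y)) (fine (h z)) (dot _ _) (dot _ _).
by move=> ht hy' hz' q1 q2 H1 H2; rewrite -(ler_pM2l t0); lra.
Qed.

End Prox.

(** * The rate for the actual iterates *)

Section ProximalGradient.
Context (R : realType) (d : nat).

Lemma sched_gt0 k : all (fun w : R => 0 < w) (sched R k).
Proof.
elim: k => // -[_|k IHk]; first by rewrite /= andbT divr_gt0.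
rewrite schedS // all_cat IHk /=.
have [e1 _ _ _] := eta_facts R (ltn0Sn k).
apply/andP; split; first by lra.
apply/allP => w /mapP[i _ ->].
by rewrite addr_gt0 // exprz_gt0 // rho_gt0.
Qed.

Lemma step_gt0 k t : (0 < k)%N -> (1 <= t <= 2 ^ k - 1)%N -> 0 < step R k t.
Proof.
move=> k0 /andP[t1 tk]; rewrite /step.
apply: (allP (sched_gt0 k)); apply: mem_nth; rewrite size_sched //; lia.
Qed.

Lemma proximal_gradient_rate (f : 'rV[R]_d -> R) (h : 'rV[R]_d -> \bar R)
    (k : nat) (x : nat -> 'rV[R]_d) (n := (2 ^ k - 1)%N) (w := step R k)
    (s := (w n)^-1 *: (x n.-1 - x n) - gradient f (x n.-1)) :
  convex_function [set: 'rV[R]_d] f -> smooth1 f ->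
  proper_fun h -> closed_fun h -> econvex_fun h -> (0 < k)%N ->
  (forall t : nat, (1 <= t <= n)%N ->
     x t = prox (w t) h (x t.-1 - w t *: gradient f (x t.-1))) ->
  subdifferential h (x n) s /\
  ((enorm (gradient f (x n) + s) ^+ 2)%:E <= (2 * Num.sqrt 2 / tau R k)%:E
    * (((f (x 0%N))%:E + h (x 0%N)) - ((f (x n))%:E + h (x n))))%E.
Proof.
move=> f_convex f_smooth h_proper h_closed h_convex k0 xE.
have n1 : (1 <= n)%N.
  have : (2 <= 2 ^ k)%N by rewrite -[leqLHS]expn1 leq_exp2l.
  rewrite /n; lia.
pose sg t := (w t)^-1 *: (x t.-1 - x t) - gradient f (x t.-1).
have x_opt t : (1 <= t <= n)%N ->
    (h (x t) < +oo)%E /\ subdifferential h (x t) (sg t).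
  move=> tn; have w0 := step_gt0 k0 tn.
  have := prox_argmin h_proper h_closed h_convex
    (x t.-1 - w t *: gradient f (x t.-1)) w0.
  rewrite -xE // => /(prox_subgradient h_proper h_convex w0).
  rewrite /sg addrAC scalerBr scalerA mulVf ?gt_eqF // scale1r.
  by [].
have nn : (1 <= n <= n)%N by rewrite n1 leqnn.
split; first by have [] := x_opt n nn.
have rate0 : 0 < 2 * Num.sqrt 2 / tau R k.
  rewrite divr_gt0 ?mulr_gt0 ?sqrtr_gt0 //.
  exact: lt_le_trans (tau_ge4 R k0).
have [hxn _] := x_opt n nn.
(* Only x_0 may lie outside the domain of h; then the right-hand side is +oo. *)
have [hx0|hx0] := eqVneq (h (x 0%N)) +oo%E.
  by rewrite hx0 (fine_proper h_proper hxn) addey // -EFinD addye // gt0_muley ?lte_fin ?leey.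
(* Freezing the iterates after n makes the inequalities hold for all indices. *)
pose y i := x (minn i n).
have hy i : (h (y i) < +oo)%E.
  rewrite /y; case: i => [|i]; first by rewrite min0n ltey.
  by have [] := x_opt (minn i.+1 n); first by rewrite geq_minr leq_min n1.
have yS i : (i < n)%N -> y i = x i /\ y i.+1 = x i.+1.
  by move=> ik; rewrite /y (minn_idPl ik) (minn_idPl (ltnW ik)).
have := @sched_rate R d y (fun i => gradient f (y i)) (fun i => sg (minn i n))
  (fun i => f (y i)) (fun i => fine (h (y i))) _ _ k k0 _.
rewrite -/n /y min0n minnn => rate.
rewrite (fine_proper h_proper hxn) (fine_proper h_proper (_ : (h (x 0%N) < +oo)%E)) ?ltey //.
rewrite -!EFinD -EFinM lee_fin enorm_sqr.
apply: rate => [i j|i j|i ik].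
- exact: gradient_cocoercive.
- have [|_ /(_ (y i))] := x_opt (minn j.+1 n); first by rewrite geq_minr leq_min n1.
  by rewrite -/(y j.+1) (fine_proper h_proper (hy i)) (fine_proper h_proper (hy j.+1)).
rewrite /pg_step /pgrad -/(y i) -/(y i.+1) (minn_idPl ik).
have [-> ->] := yS i ik.
rewrite -[nth _ _ _]/(w i.+1) /sg /= addrCA subrr addr0 scalerA.
by rewrite mulfV ?gt_eqF ?step_gt0 // scale1r subKr.
Qed.
End ProximalGradient.

(** * Asymptotics of the rate *)

Section Asymptotics.
Context (R : realType).

Definition tau_map (t : R) : R := (t + 4 + Num.sqrt (t ^+ 2 + 8 * t)) / (2 * rho R).

Definition tau_lim : R := 2 / (rho R - Num.sqrt (rho R)).

Lemma sqrt_rho_facts (q := Num.sqrt (rho R)) :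
  [/\ 1 < q, q < 2 & q * q = rho R].
Proof.
have r2 := rho_gt2 R; have r3 : rho R < 4.
  by rewrite /rho; have := sqrt2_lt32 R; lra.
have q0 : 0 <= q by exact: sqrtr_ge0.
have qq : q * q = rho R by rewrite -expr2 sqr_sqrtr // ltW // rho_gt0.
split=> //; nra.
Qed.

(** With q = sqrt rho the limit satisfies L (q^2 - q) = 2, which makes L^2 + 8 L the square of L (2
    q - 1). *)
Lemma tau_lim_fixed : 1 <= tau_lim /\ tau_map tau_lim = tau_lim.
Proof.
have [q1 q2 qq] := sqrt_rho_facts; rewrite /tau_map /tau_lim.
move: (Num.sqrt (rho R)) q1 q2 qq => q q1 q2 <-.
have D0 : 0 < q * q - q by nra.
have q0 : q != 0 by rewrite gt_eqF //; lra.
split; first by rewrite ler_pdivlMr //; nra.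
set L := 2 / _.
have LE : L * (q * q - q) = 2 by rewrite divfK // gt_eqF.
have L0 : 0 < L by rewrite divr_gt0.
have -> : L ^+ 2 + 8 * L = (L * (2 * q - 1)) ^+ 2.
  transitivity (L ^+ 2 + 4 * L * (L * (q * q - q))); last by ring.
  by rewrite LE; ring.
rewrite sqrtr_sqr ger0_norm; last by apply: mulr_ge0; lra.
have -> : 4 = 2 * (L * (q * q - q)) by rewrite LE; ring.
by field.
Qed.

(** On [1, +oo) the square root has slope at most 5/3, attained at 1, and rho > 2, so the factor is
    at most (1 + 5/3) / 4 = 2/3. *)
Lemma tau_map_contraction t L : 1 <= t -> 1 <= L ->
  `|tau_map t - tau_map L| <= 2 / 3 * `|t - L|.
Proof.
move=> t1 L1; have r2 := rho_gt2 R.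
have St0 := sqrtr_ge0 (t ^+ 2 + 8 * t).
have SL0 := sqrtr_ge0 (L ^+ 2 + 8 * L).
have sq (y : R) : 1 <= y -> Num.sqrt (y ^+ 2 + 8 * y) ^+ 2 = y ^+ 2 + 8 * y.
  by move=> y1; rewrite sqr_sqrtr // addr_ge0 ?sqr_ge0 //; lra.
have St := sq _ t1; have SL := sq _ L1.
rewrite /tau_map -mulrBl.
move: (Num.sqrt _) (Num.sqrt _) St0 SL0 St SL => T S S0 T0 SS TT.
have sq_le (y Y : R) : 1 <= y -> 0 <= Y -> Y ^+ 2 = y ^+ 2 + 8 * y -> y + 4 <= 5 / 3 * Y.
  move=> y1 Y0 YY; rewrite -(ler_pXn2r (ltn0Sn 1)) ?nnegrE; [|lra|lra].
  rewrite exprMn YY; have : 0 <= (y - 1) * (y + 9) by apply: mulr_ge0; lra.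
  lra.
have St := sq_le _ _ t1 S0 SS; have TL := sq_le _ _ L1 T0 TT.
have ST : (S - T) * (S + T) = (t - L) * (t + L + 8).
  have -> : (S - T) * (S + T) = S ^+ 2 - T ^+ 2 by ring.
  by rewrite SS TT; ring.
have ST0 : 0 < S + T by lra.
have dST : `|S - T| <= 5 / 3 * `|t - L|.
  rewrite -(ler_pM2r ST0) -{1}(gtr0_norm ST0) -normrM ST normrM.
  rewrite [5 / 3 * _]mulrC -mulrA ler_wpM2l // ger0_norm; lra.
rewrite normrM normfV (gtr0_norm (_ : 0 < 2 * rho R)); last by lra.
rewrite ler_pdivrMr; last by lra.
have -> : t + 4 + S - (L + 4 + T) = (t - L) + (S - T) by ring.
apply: (le_trans (ler_normD _ _)).
have := normr_ge0 (t - L); move: `|t - L| `|S - T| dST => u v dST u0; nra.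
Qed.

Lemma tau_normalizedS k : (0 < k)%N ->
  tau R k.+1 / rho R ^+ k.+1 = tau_map (tau R k / rho R ^+ k).
Proof.
move=> k0; rewrite tauS // /tau_map [rho R ^+ k.+1]exprS.
have r0 := rho_neq0 R.
have : 0 < rho R ^+ k by rewrite exprn_gt0 // rho_gt0.
move: (rho R ^+ k) (tau R k) => a t a0.
have aN : a != 0 by rewrite gt_eqF.
have -> : t ^+ 2 + 8 * a * t = a ^+ 2 * ((t / a) ^+ 2 + 8 * (t / a)) by field.
rewrite sqrtrM ?sqr_ge0 // sqrtr_sqr gtr0_norm //.
by field; rewrite r0 aN.

Qed.

Lemma tau_normalized_ge1 k : (0 < k)%N -> 1 <= tau R k / rho R ^+ k.
Proof.
have r2 := rho_gt2 R; have r4 : rho R <= 4.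
  by rewrite /rho; have := sqrt2_lt32 R; lra.
elim: k => // -[_ _|k IHk _].
  by rewrite expr1 ler_pdivlMr ?mul1r // rho_gt0.
rewrite tau_normalizedS // /tau_map; have {IHk} := IHk isT.
move: (_ / _) => t t1; rewrite ler_pdivlMr; last by lra.
have : Num.sqrt (3 ^+ 2) <= Num.sqrt (t ^+ 2 + 8 * t) by apply: ler_wsqrtr; nra.
by rewrite sqrtr_sqr ger0_norm //; lra.
Qed.

Lemma tau_normalized_cvg :
  (fun k => tau R k.+1 / rho R ^+ k.+1) @ \oo --> tau_lim.
Proof.
have [L1 fixL] := tau_lim_fixed.
have bound k : `|tau R k.+1 / rho R ^+ k.+1 - tau_lim|
    <= `|tau R 1 / rho R ^+ 1 - tau_lim| * (2 / 3) ^+ k.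
  elim: k => [|k IHk]; first by rewrite expr0 mulr1.
  rewrite (tau_normalizedS (ltn0Sn k)) -{1}fixL.
  apply: le_trans (tau_map_contraction (tau_normalized_ge1 (ltn0Sn k)) L1) _.
  by rewrite [(2 / 3) ^+ k.+1]exprS mulrCA ler_wpM2l.
have lim0 : (fun k => `|tau R 1 / rho R ^+ 1 - tau_lim| * (2 / 3) ^+ k) @ \oo --> (0 : R).
  by apply: cvg_geometric; rewrite ger0_norm; lra.
have : (fun k => `|tau R k.+1 / rho R ^+ k.+1 - tau_lim|) @ \oo --> (0 : R).
  apply: (squeeze_cvgr _ (cvg_cst 0) lim0).
  by near=> k; rewrite normr_ge0 /= bound.
move=> /norm_cvg0P H.
have -> : (fun k => tau R k.+1 / rho R ^+ k.+1)
    = (fun k => tau R k.+1 / rho R ^+ k.+1 - tau_lim) + (fun=> tau_lim).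
  by apply/funext => k; rewrite /= [RHS]subrK.
rewrite -[X in _ --> X]add0r; by apply: cvgD => //; exact: cvg_cst.
Unshelve. all: by end_near. Qed.

(** The exponent is log_2 rho, so the factor 2^(k+1) of the base contributes rho^(k+1); the other
    factor tends to 1. *)
Lemma pow2_pred_powR k :
  (2 ^ k.+1 - 1)%:R `^ (ln (rho R) / ln 2)
  = rho R ^+ k.+1 * expR (ln (rho R) / ln 2 * ln (1 - 2^-1 ^+ k.+1)) :> R.
Proof.
have u0 : 0 < 1 - 2^-1 ^+ k.+1 :> R.
  by rewrite subr_gt0 exprn_ilt1 // ?invr_ge0 // invf_lt1 // ltr1n.
have p0 : 0 < 2 ^+ k.+1 :> R by rewrite exprn_gt0.
have nE : (2 ^ k.+1 - 1)%:R = 2 ^+ k.+1 * (1 - 2^-1 ^+ k.+1) :> R.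
  by rewrite natrB ?expn_gt0 // natrX mulrBr mulr1 exprVn mulfV //.
rewrite nE /powR gt_eqF ?mulr_gt0 // lnM ?posrE // mulrDr expRD; congr (_ * _).
rewrite lnXn // -[ln 2 *+ _]mulr_natl mulrCA divfK; last first.
  by rewrite gt_eqF // ln_gt0 // ltr1n.
by rewrite expRM_natl lnK // posrE rho_gt0.
Qed.

Lemma tau_rate_asymp : asymp_equiv
  (fun k : nat => 2 * Num.sqrt 2 / tau R k)
  (fun k : nat => Num.sqrt 2 * (rho R - Num.sqrt (rho R))
                    / ((2 ^ k - 1)%:R `^ (ln (rho R) / ln 2))).
Proof.
(* The shift discards the dummy value [tau R 0]. *)
rewrite /asymp_equiv -cvg_shiftS /=.
have [L1 _] := tau_lim_fixed.
pose p := ln (rho R) / ln 2.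
pose v (k : nat) : R := expR (p * ln (1 - 2^-1 ^+ k.+1)).
have vlim : v @ \oo --> (1 : R).
  have half0 : (fun k => 2^-1 ^+ k.+1) @ \oo --> (0 : R).
    rewrite (cvg_shiftS (fun k : nat => 2^-1 ^+ k : R)).
    by apply: cvg_expr; rewrite ger0_norm ?invr_ge0 // invf_lt1 // ltr1n.
  have u1 : (fun k => 1 - 2^-1 ^+ k.+1) @ \oo --> (1 : R).
    rewrite -[X in _ --> X]subr0.
    by apply: cvgB => //; exact: cvg_cst.
  have lnu : ln (1 - 2^-1 ^+ k.+1 : R) @[k --> \oo] --> (ln 1 : R).
    by apply: continuous_cvg => //; exact: continuous_ln.
  have plnu : p * ln (1 - 2^-1 ^+ k.+1 : R) @[k --> \oo] --> p * ln 1.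
    by apply: cvgM => //; exact: cvg_cst.
  have : v @ \oo --> expR (p * ln 1).
    by apply: continuous_cvg => //; exact: continuous_expR.
  by rewrite ln1 mulr0 expR0.
have E : (fun k : nat => 2 * Num.sqrt 2 / tau R k.+1 /
   (Num.sqrt 2 * (rho R - Num.sqrt (rho R)) / (2 ^ k.+1 - 1)%:R `^ p))
  = (fun k => tau_lim * (tau R k.+1 / rho R ^+ k.+1)^-1 * v k).
  apply/funext => k; rewrite pow2_pred_powR -/(v k) /tau_lim.
  have [q1 q2 qq] := sqrt_rho_facts.
  have a0 : rho R ^+ k.+1 != 0 by rewrite expf_neq0 // rho_neq0.
  have s0 : Num.sqrt 2 != 0 :> R by rewrite gt_eqF // sqrtr_gt0.
  have t0 : tau R k.+1 != 0 by rewrite gt_eqF // (lt_le_trans _ (tau_ge4 _ _)).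
  have v0 : v k != 0 by rewrite gt_eqF // expR_gt0.
  have D0 : rho R - Num.sqrt (rho R) != 0.
    by rewrite gt_eqF //; move: qq; nra.
  by field; rewrite a0 s0 t0 v0 D0.
rewrite E.
have L0 : tau_lim != 0 by rewrite gt_eqF // (lt_le_trans ltr01).
have : (fun k => tau_lim * (tau R k.+1 / rho R ^+ k.+1)^-1 * v k) @ \oo
    --> tau_lim / tau_lim * 1.
  apply: cvgM => //; apply: cvgM; first exact: cvg_cst.
  by apply: cvgV => //; exact: tau_normalized_cvg.
by rewrite mulfV // mulr1.
Qed.

End Asymptotics.

Theorem theorem5p3 (R : realType) :
  (forall (d : nat) (f : 'rV[R]_d -> R) (h : 'rV[R]_d -> \bar R)
      (k : nat) (x : nat -> 'rV[R]_d),
    let n := (2 ^ k - 1)%N in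
    let w := step R k in
    let F := fun z : 'rV[R]_d => ((f z)%:E + h z)%E in
    let s := (w n)^-1 *: (x n.-1 - x n) - gradient f (x n.-1) in
    convex_function [set: 'rV[R]_d] f ->
    smooth1 f ->
    proper_fun h -> closed_fun h -> econvex_fun h ->
    (0 < k)%N ->
    (forall t : nat, (1 <= t <= n)%N ->
      x t = prox (w t) h (x t.-1 - w t *: gradient f (x t.-1))) ->
    subdifferential h (x n) s /\
    ((enorm (gradient f (x n) + s) ^+ 2)%:E
       <= (2 * Num.sqrt 2 / tau R k)%:E * (F (x 0%N) - F (x n)))%E) /\
  asymp_equiv
    (fun k : nat => 2 * Num.sqrt 2 / tau R k)
    (fun k : nat => Num.sqrt 2 * (rho R - Num.sqrt (rho R))
                    / ((2 ^ k - 1)%:R `^ (ln (rho R) / ln 2))).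
Proof.
split; last exact: tau_rate_asymp.
by move=> d f h k x n w F s *; exact: proximal_gradient_rate.
Qed.
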